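(* Let $\gamma>0$ and let $\mu$ be a distribution on $\mathbb{R}$ such that the function $x\mapsto e^{\gamma x}\bar\mu(x)$ belongs to $\mathbf{M}$. If $\mu^{n*}\in\mathcal{S}(\gamma)$ for some $n\in\mathbb{N}$, then $\mu\in\mathcal{S}(\gamma)$.
   Context: For a probability distribution $\rho$ on $\mathbb{R}$: $\bar\rho(x):=\rho((x,\infty))$, $\rho^{n*}$ is the $n$-th convolution power, $\widehat\rho(\gamma):=\int e^{\gamma x}\rho(dx)$. $f\sim g$ means $f(x)/g(x)\to1$ as $x\to\infty$. For $\gamma\ge0$: $\rho\in\mathcal{L}(\gamma)$ if $\bar\rho(x)>0$ for all $x$ and $\bar\rho(x+a)\sim e^{-\gamma a}\bar\rho(x)$ for every $a\in\mathbb{R}$; $\rho\in\mathcal{S}(\gamma)$ if $\rho\in\mathcal{L}(\gamma)$, $\widehat\rho(\gamma)<\infty$ and $\overline{\rho^{2*}}(x)\sim2\widehat\rho(\gamma)\bar\rho(x)$. A nonnegative measurable function $g$ on $\mathbb{R}$ is in $\mathbf{L}$ if $g(x)>0$ for all sufficiently large $x$ and $g(x+a)\sim g(x)$ for every $a\in\mathbb{R}$. A nonnegative measurable function $g$ on $\mathbb{R}$ is in $\mathbf{M}$ if $g(x)>0$ for all sufficiently large $x$ and there exist $a\in[0,1]$, $f_1\in\mathbf{L}$, and a positive, (weakly) decreasing function $f_2$ on $\mathbb{R}$ such that $g(x)\sim af_1(x)+(1-a)f_2(x)$. *)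

(* Defs.v *)
From HB Require Import structures.
From mathcomp Require Import all_boot all_order all_algebra.
From mathcomp Require Import all_classical all_reals all_analysis.
Set Implicit Arguments. Unset Strict Implicit. Unset Printing Implicit Defensive.
Import Order.TTheory GRing.Theory Num.Theory.
Import numFieldNormedType.Exports.
Local Open Scope classical_set_scope.
Local Open Scope ring_scope.

Section Defs.
Variable R : realType.

(* tail function  rho-bar(x) = rho((x, +oo)) (real-valued; finite for probabilities) *)
Definition tail (rho : set R -> \bar R) (x : R) : R := fine (rho [set` `]x, +oo[%classic]).

Definition asym_eq (f g : R -> R) : Prop :=
  (fun x => f x / g x) @ +oo --> (1 : R).

Definition mgf (rho : {measure set R -> \bar R}) (gamma : R) : \bar R :=
  (\int[rho]_x (expR (gamma * x))%:E)%E.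

Definition conv (m1 : {measure set R -> \bar R}) (m2 : set R -> \bar R)
  (A : set R) : \bar R :=
  (\int[m1]_x m2 ((fun y : R => (x + y)%R) @^-1` A))%E.

Fixpoint convpow (mu : {measure set R -> \bar R}) (n : nat) : set R -> \bar R :=
  match n with
  | 0 => @dirac _ R 0 R
  | n'.+1 => conv mu (convpow mu n')
  end.

Definition classLgamma (gamma : R) (rho : {measure set R -> \bar R}) : Prop :=
  (forall x, 0 < tail rho x) /\
  (forall a : R, asym_eq (fun x => tail rho (x + a))
                         (fun x => expR (- gamma * a) * tail rho x)).

Definition classSgamma (gamma : R) (rho : {measure set R -> \bar R}) : Prop :=
  classLgamma gamma rho /\
  (mgf rho gamma < +oo)%E /\
  asym_eq (tail (conv rho rho)) (fun x => 2 * fine (mgf rho gamma) * tail rho x).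

Definition classL (g : R -> R) : Prop :=
  (forall x, 0 <= g x) /\ measurable_fun setT g /\
  (\forall x \near +oo, 0 < g x) /\
  (forall a : R, asym_eq (fun x => g (x + a)) g).

Definition classM (g : R -> R) : Prop :=
  (forall x, 0 <= g x) /\ measurable_fun setT g /\
  (\forall x \near +oo, 0 < g x) /\
  exists (a : R) (f1 f2 : R -> R),
    0 <= a <= 1 /\ classL f1 /\
    (forall x, 0 < f2 x) /\ (forall x y, x <= y -> f2 y <= f2 x) /\
    asym_eq g (fun x => a * f1 x + (1 - a) * f2 x).

End Defs.

(* Main.v *)
(* All tails are compared modulo o(N), N being the tail of nu = mu * rho with
   rho = mu^{(n-1)*}.  Since nu is convolution equivalent, N absorbs the event
   that both summands of a convolution of dominated laws are large, so the tail
   of mu * rho at x is, up to o(N), the sum of the two one-jump integrals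
   int_{|y| <= A} mu-bar(x - y) rho(dy) and int_{|y| <= A} rho-bar(x - y) mu(dy).
   Class M says that exp(gamma x) mu-bar(x) is asymptotically decreasing, and this
   passes to convolution powers.  As exp(gamma x) N(x) is asymptotically constant
   under shifts, neither one-jump integral can decrease by a fraction of N, which
   forces mu-bar(x + s) to be exp(-gamma s) mu-bar(x) + o(N(x)).  An induction on
   the powers of mu then gives N = O(mu-bar), so mu is in L(gamma), and the
   one-jump decomposition of mu * mu yields mu in S(gamma); the Wiener condition
   on the Fourier transform of mu is thus replaced by monotonicity. *)
Require Import Defs.
From HB Require Import structures.
From mathcomp Require Import all_boot all_order all_algebra.
From mathcomp Require Import all_classical all_reals all_analysis.
From mathcomp Require Import measurable_realfun ring lra.
Import Order.TTheory GRing.Theory Num.Theory.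
Import numFieldNormedType.Exports.
Local Open Scope classical_set_scope.
Local Open Scope ring_scope.

(** * Measurability of level sets *)

Section Measurability.
Context {d : measure_display} {T : measurableType d} {R : realType}.
Implicit Types (f : T -> R) (c : R).

Lemma measurable_set_gt f c : measurable_fun setT f ->
  measurable [set z | c < f z].
Proof.
move=> mf; have -> : [set z | c < f z] = setT `&` f @^-1` `]c, +oo[%classic.
  by rewrite setTI; apply/seteqP; split=> z /=; rewrite in_itv/= andbT.
exact: mf.
Qed.

Lemma measurable_set_le f c : measurable_fun setT f ->
  measurable [set z | f z <= c].
Proof.
move=> mf; have -> : [set z | f z <= c] = setT `&` f @^-1` `]-oo, c]%classic.
  by rewrite setTI; apply/seteqP; split=> z /=; rewrite in_itv.
exact: mf.
Qed.

End Measurability.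

(** * Tails of probability measures on the line *)

Section Tail.
Context {R : realType}.
Implicit Types (m : probability R R).

Lemma tailE m x : (m `]x, +oo[%classic = (tail m x)%:E)%E.
Proof.
rewrite /tail set_mem_set fineK//; exact: fin_num_measure.
Qed.

Lemma tail_ge0 m x : 0 <= tail m x.
Proof. by rewrite fine_ge0. Qed.

Lemma tail_le1 m x : tail m x <= 1.
Proof. by rewrite -lee_fin -tailE probability_le1. Qed.

Lemma tail_anti m x y : x <= y -> tail m y <= tail m x.
Proof.
move=> xy; rewrite -lee_fin -!tailE le_measure ?inE// => z /=.
rewrite !in_itv/= !andbT; exact: le_lt_trans.
Qed.

End Tail.

(** * Product of two laws, with real-valued masses *)

Section Joint.
Context {R : realType}.
Implicit Types (m r : probability R R) (S : set (R * R)).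

Definition jointP m1 m2 : probability (R * R)%type R := (m1 \x m2)%E.

Definition joint m1 m2 S : R := fine (jointP m1 m2 S).

Lemma jointE m1 m2 S : measurable S -> jointP m1 m2 S = (joint m1 m2 S)%:E.
Proof. by move=> mS; rewrite fineK //; exact: fin_num_measure. Qed.

Lemma joint_ge0 m1 m2 S : 0 <= joint m1 m2 S.
Proof. by rewrite fine_ge0. Qed.

Lemma le_joint m1 m2 S S' : measurable S -> measurable S' -> S `<=` S' ->
  joint m1 m2 S <= joint m1 m2 S'.
Proof. by move=> mS mS' SS'; rewrite -lee_fin -!jointE// le_measure ?inE. Qed.

Lemma jointU m1 m2 S S' : measurable S -> measurable S' ->
  joint m1 m2 (S `|` S') <= joint m1 m2 S + joint m1 m2 S'.
Proof.
move=> mS mS'; rewrite -lee_fin EFinD -!jointE//; last exact: measurableU.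
exact: measureU2.
Qed.

Lemma jointU_disj m1 m2 S S' : measurable S -> measurable S' ->
  S `&` S' = set0 -> joint m1 m2 (S `|` S') = joint m1 m2 S + joint m1 m2 S'.
Proof.
move=> mS mS' SS'; apply: EFin_inj; rewrite EFinD -!jointE//; last exact: measurableU.
by rewrite measureU.
Qed.

(** The product is built by integrating sections over the first coordinate; the product built in the
    other order agrees with it on rectangles, hence everywhere by uniqueness. *)
Lemma joint_ysection m1 m2 S : measurable S ->
  jointP m1 m2 S = (\int[m2]_y m1 (ysection S y))%E.
Proof.
move=> mS; apply: (product_measure_unique (m' := (m1 \x^ m2)%E)) => // A B mA mB.
exact: product_measure2E.
Qed.

Definition swap (z : R * R) := (z.2, z.1).

Lemma joint_swap m1 m2 S : measurable S ->
  joint m1 m2 S = joint m2 m1 (swap @^-1` S).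
Proof.
move=> mS.
have mS' : measurable (swap @^-1` S) by rewrite -[X in measurable X]setTI; exact: measurable_swap.
congr fine; rewrite (joint_ysection _ _ _ mS').
apply: eq_integral => x _ /=; congr (m2 _).
Qed.

End Joint.

(** * Splitting the tail of a sum into one-jump and two-jump events *)

Section Splitting.
Context {R : realType}.
Implicit Types (m r : probability R R) (S : set (R * R)) (A x : R).

(** An inequality between tails only compares the two laws on upper half-lines, so it passes to the
    product for sets all of whose sections in the first variable are empty or such half-lines. *)
Lemma joint_dom m r m2 S C : measurable S -> 0 <= C ->
  (forall x, tail m x <= C * tail r x) ->
  (forall y, ysection S y = set0 \/ exists c, ysection S y = `]c, +oo[%classic) ->
  joint m m2 S <= C * joint r m2 S.
Proof.
move=> mS C0 mr Sup; rewrite -lee_fin EFinM -!jointE//.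
rewrite !joint_ysection// -ge0_integralZl//; last exact: measurable_fun_ysection.
apply: ge0_le_integral => //.
- exact: measurable_fun_ysection.
- by apply: measurable_funeM; exact: measurable_fun_ysection.
- move=> y _; have [->|[c ->]] := Sup y; first by rewrite !measure0 mule0.
  by rewrite !tailE -EFinM lee_fin.
Qed.

Definition sum_gt x : set (R * R) := [set z | x < z.1 + z.2].
Definition snd_in A : set (R * R) := [set z | `|z.2| <= A].
Definition fst_in A : set (R * R) := [set z | `|z.1| <= A].
Definition both_gt A : set (R * R) := [set z | A < z.1] `&` [set z | A < z.2].

Definition sum_tail m r x := joint m r (sum_gt x).
Definition two_jumps m r A x := joint m r (both_gt A `&` sum_gt x).
(** The summand of law [r] stays in the window [- A, A], so the summand of law [m] has to make the
    jump. *)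
Definition one_jump m r A x := \int[r]_(y in `[- A, A]) tail m (x - y).

Lemma measurable_sum_gt x : measurable (sum_gt x).
Proof. by apply: measurable_set_gt; exact: measurable_funD. Qed.

Lemma measurable_snd_in A : measurable (snd_in A).
Proof. by apply: measurable_set_le; exact: measurableT_comp. Qed.

Lemma measurable_fst_in A : measurable (fst_in A).
Proof. by apply: measurable_set_le; exact: measurableT_comp. Qed.

Lemma measurable_both_gt A : measurable (both_gt A).
Proof. by apply: measurableI; exact: measurable_set_gt. Qed.

Hint Resolve measurable_sum_gt measurable_snd_in measurable_fst_in
  measurable_both_gt : core.

Lemma tail_conv m r x : tail (Defs.conv m r) x = sum_tail m r x.
Proof.
rewrite /tail set_mem_set; congr fine.
apply: eq_integral => y _ /=; congr (r _).
by apply/seteqP; split=> z /=; rewrite /xsection /= in_itv/= andbT inE.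
Qed.

Lemma one_jumpE m r A x : joint m r (snd_in A `&` sum_gt x) = one_jump m r A x.
Proof.
rewrite /joint /one_jump /Rintegral joint_ysection; last exact: measurableI.
rewrite [in RHS]integral_mkcond; congr fine; apply: eq_integral => y _.
rewrite patchE mem_setE in_itv/= -ler_norml; case: ifPn => yA.
  rewrite -tailE; congr (m _); apply/seteqP; split=> z /=; rewrite /ysection/= inE in_itv/= andbT.
    by case=> _; rewrite /sum_gt /= ltrBlDr.
  by rewrite ltrBlDr.
rewrite (_ : ysection _ _ = set0) ?measure0//; apply/seteqP; split=> z //=.
by rewrite /ysection/= inE => -[]; rewrite /snd_in/= (negbTE yA).
Qed.

Lemma one_jump_swapE m r A x : joint m r (fst_in A `&` sum_gt x) = one_jump r m A x.
Proof.
rewrite joint_swap; last exact: measurableI.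
rewrite -one_jumpE; congr joint; apply/seteqP.
by split=> -[y z] [] /=; rewrite /sum_gt /= addrC.
Qed.

(** If both summands lie in [- A, A], their sum is at most 2 * A <= x. Hence the two one-jump events
    are disjoint, and both avoid the event that the two summands exceed A. *)
Lemma sum_tail_ge m r A x : 0 <= A -> 2 * A <= x ->
  one_jump m r A x + one_jump r m A x + two_jumps m r A x <= sum_tail m r x.
Proof.
move=> A0 Ax.
have mJ : measurable (both_gt A `&` sum_gt x) by exact: measurableI.
have ms : measurable (snd_in A `&` sum_gt x) by exact: measurableI.
have mf : measurable (fst_in A `&` sum_gt x) by exact: measurableI.
rewrite -one_jumpE -one_jump_swapE /two_jumps -jointU_disj//; last first.
  apply/seteqP; split=> z //=; rewrite /snd_in /fst_in /sum_gt/= => -[[+ ?] [+ _]].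
  by rewrite !ler_norml; lra.
have msf : measurable ((snd_in A `&` sum_gt x) `|` (fst_in A `&` sum_gt x)).
  exact: measurableU.
rewrite -jointU_disj//; last first.
  apply/seteqP; split=> z //=; rewrite /snd_in /fst_in /both_gt /sum_gt/=.
  by rewrite !ler_norml; lra.
apply: le_joint => //; first exact: measurableU.
by move=> z [[|]|] [].
Qed.

(** Outside the one-jump and two-jump events some summand is below - A, so the other one exceeds x +
    A; this produces the last two terms. *)
Lemma sum_tail_le m r A x : 0 <= A ->
  sum_tail m r x <= one_jump m r A x + one_jump r m A x + two_jumps m r A x
    + tail m (x + A) + tail r (x + A).
Proof.
move=> A0.
have tm : joint m r [set z | x + A < z.1] = tail m (x + A).
  rewrite /joint /tail set_mem_set (_ : [set z | _] = `]x + A, +oo[%classic `*` setT).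
    by rewrite /jointP /= product_measure1E// -[in RHS](mule1 (m _)) -(probability_setT r).
  by apply/seteqP; split=> z /=; rewrite in_itv/= andbT; tauto.
have tr : joint m r [set z | x + A < z.2] = tail r (x + A).
  rewrite /joint /tail set_mem_set (_ : [set z | _] = setT `*` `]x + A, +oo[%classic).
    by rewrite /jointP /= product_measure1E// -[in RHS](mul1e (r _)) -(probability_setT m).
  by apply/seteqP; split=> z /=; rewrite in_itv/= andbT; tauto.
have m1 : measurable [set z : R * R | x + A < z.1] by exact: measurable_set_gt.
have m2 : measurable [set z : R * R | x + A < z.2] by exact: measurable_set_gt.
have mJ : measurable (both_gt A `&` sum_gt x) by exact: measurableI.
have ms : measurable (snd_in A `&` sum_gt x) by exact: measurableI.
have mf : measurable (fst_in A `&` sum_gt x) by exact: measurableI.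
rewrite -one_jumpE -one_jump_swapE -tm -tr.
apply: le_trans (_ : joint m r ((((snd_in A `&` sum_gt x) `|` (fst_in A `&` sum_gt x))
   `|` (both_gt A `&` sum_gt x)) `|` [set z | x + A < z.1] `|` [set z | x + A < z.2]) <= _).
  apply: le_joint => //; first by do !apply: measurableU => //.
  move=> [y z]; rewrite /snd_in /fst_in /both_gt /sum_gt/= => xyz.
  rewrite !ler_norml.
  have [|zA] := boolP (-A <= z <= A); first by left; left; left; left.
  have [|yA] := boolP (-A <= y <= A); first by left; left; left; right.
  have [zA'|zA'] := ltP z (-A); first by left; right; lra.
  have [yA'|yA'] := ltP y (-A); first by right; lra.
  rewrite zA' /= -ltNge in zA; rewrite yA' /= -ltNge in yA.
  by left; left; right.
rewrite (le_trans (jointU _ _ _ _ _ _))//; first by do !apply: measurableU => //.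
rewrite lerD2r (le_trans (jointU _ _ _ _ _ _))//; first by do !apply: measurableU => //.
rewrite lerD2r (le_trans (jointU _ _ _ _ _ _))//; first by do !apply: measurableU => //.
by rewrite lerD2r jointU.
Qed.

Lemma two_jumpsC m r A x : two_jumps m r A x = two_jumps r m A x.
Proof.
rewrite /two_jumps joint_swap; last exact: measurableI.
congr joint; apply/seteqP.
by split=> -[y z] [[] /=]; rewrite /sum_gt /= addrC.
Qed.

Lemma sum_tailC m r x : sum_tail m r x = sum_tail r m x.
Proof.
rewrite /sum_tail joint_swap//; congr joint; apply/seteqP.
by split=> -[y z] /=; rewrite /sum_gt /= addrC.
Qed.

Lemma two_jumps_dom1 m r m2 C A x : 0 <= C ->
  (forall x, tail m x <= C * tail r x) ->
  two_jumps m m2 A x <= C * two_jumps r m2 A x.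
Proof.
move=> C0 mr; apply: joint_dom => //; first exact: measurableI.
move=> y; have [Ay|yA] := ltP A y.
  (* For y > A the constraints z > A and z > x - y define one half-line; for y <= A the section is
     empty. *)
  right; exists (Num.max A (x - y)); apply/seteqP; split=> z /=;
    rewrite /ysection/= inE in_itv/= andbT gt_max ltrBlDr.
    by move=> [[/= -> _]].
  by move=> /andP[].
left; apply/seteqP; split=> z //=.
by rewrite /ysection/= inE => -[[_]] /=; rewrite ltNge yA.
Qed.

Lemma sum_tail_dom1 m r m2 C x : 0 <= C ->
  (forall x, tail m x <= C * tail r x) ->
  sum_tail m m2 x <= C * sum_tail r m2 x.
Proof.
move=> C0 mr; apply: joint_dom => //.
move=> y; right; exists (x - y); apply/seteqP; split=> z /=;
    by rewrite /ysection/= inE in_itv/= andbT ltrBlDr.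
Qed.

Lemma two_jumps_dom m m' r C C' A x : 0 <= C -> 0 <= C' ->
  (forall x, tail m x <= C * tail r x) ->
  (forall x, tail m' x <= C' * tail r x) ->
  two_jumps m m' A x <= C * C' * two_jumps r r A x.
Proof.
move=> C0 C'0 mr m'r; rewrite (le_trans (two_jumps_dom1 _ _ _ _ _ _ C0 mr))//.
by rewrite -mulrA ler_wpM2l// two_jumpsC two_jumps_dom1.
Qed.

Lemma sum_tail_dom m m' r C C' x : 0 <= C -> 0 <= C' ->
  (forall x, tail m x <= C * tail r x) ->
  (forall x, tail m' x <= C' * tail r x) ->
  sum_tail m m' x <= C * C' * sum_tail r r x.
Proof.
move=> C0 C'0 mr m'r; rewrite (le_trans (sum_tail_dom1 _ _ _ _ _ C0 mr))//.
by rewrite -mulrA ler_wpM2l// sum_tailC sum_tail_dom1.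
Qed.

(** The sum exceeds x on the rectangle where the first summand exceeds x + A and the second exceeds
    - A. *)
Lemma sum_tail_ge_tail m r A x : tail r (- A) * tail m (x + A) <= sum_tail m r x.
Proof.
rewrite /sum_tail.
have mI t : measurable (`]t, +oo[%classic : set R) by [].
apply: le_trans (_ : joint m r (`]x + A, +oo[ `*` `]- A, +oo[) <= _).
  rewrite -lee_fin -jointE; last exact: measurableX.
  by rewrite /jointP /= product_measure1E// EFinM -!tailE muleC.
apply: le_joint => //; first exact: measurableX.
by move=> z /= []; rewrite /sum_gt/= !in_itv/= !andbT; lra.
Qed.

End Splitting.

(** * Convolution powers as probability measures *)

Section ConvolutionPowers.
Context {R : realType}.
Implicit Types (mu r : probability R R).

(** [conv] only gives a set function; the law of the sum under the product measure realises it as a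
    probability. *)
Lemma conv_probability mu r : exists r' : probability R R,
  forall A, measurable A -> r' A = Defs.conv mu r A.
Proof.
have madd : measurable_fun setT (fun z : R * R => z.1 + z.2) by exact: measurable_funD.
pose add := HB.pack_for {mfun (R * R)%type >-> R} (fun z : R * R => z.1 + z.2)
  (isMeasurableFun.Build _ _ _ _ _ madd).
exists (distribution (jointP mu r) add) => A mA.
apply: eq_integral => y _ /=; congr (r _).
by apply/seteqP; split=> z /=; rewrite /xsection /= inE.
Qed.

Lemma eq_conv mu (f g : set R -> \bar R) A : measurable A ->
  (forall B, measurable B -> f B = g B) -> Defs.conv mu f A = Defs.conv mu g A.
Proof.
move=> mA fg; apply: eq_integral => y _; apply: fg.
rewrite -[X in measurable X]setTI; apply: measurable_funD => //.
Qed.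

(** Induction along the powers for properties that depend on tails only. The base case is the Dirac
    mass at 0, of which only the vanishing of the tail on [0, +oo) is retained. *)
Lemma convpow_ind mu (Q : probability R R -> Prop) (k : nat) :
  (forall r, (forall x, 0 <= x -> tail r x = 0) -> Q r) ->
  (forall r r', (forall x, tail r' x = sum_tail mu r x) -> Q r -> Q r') ->
  exists r : probability R R, Q r /\ forall A, measurable A -> r A = convpow mu k A.
Proof.
move=> Q0 QS; elim: k => [|k [r [Qr rE]]].
  exists (\d_(0:R)); split => //; apply: Q0 => x x0.
  by rewrite /tail set_mem_set /dirac /= indicE mem_setE in_itv/= ltNge x0.
have [r' r'E] := conv_probability mu r; exists r'; split.
  apply: QS Qr => x; rewrite -tail_conv /tail set_mem_set r'E//.
by move=> A mA; rewrite r'E//=; apply: eq_conv.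
Qed.

End ConvolutionPowers.

(** * Truncated integrals and exponential moments *)

Section TruncatedIntegrals.
Context {R : realType}.
Implicit Types (m r : probability R R).

Lemma integrable_trunc r A (f : R -> R) (M : R) : measurable_fun setT f ->
  (forall y, - A <= y <= A -> `|f y| <= M) -> r.-integrable `[- A, A] (EFin \o f).
Proof.
move=> mf fM; apply: measurable_bounded_integrable => //.
- by rewrite (le_lt_trans (probability_le1 _ _))// ltry.
- exact: measurable_funTS.
- exists M; split; first exact: num_real.
  by move=> N MN y /=; rewrite in_itv/= => /fM /le_trans; apply; exact: ltW.
Qed.

Lemma integrable_tail m r A x :
  r.-integrable `[- A, A] (EFin \o (fun y => tail m (x - y))).
Proof.
apply: (integrable_trunc _ _ _ 1).
  apply: nondecreasing_measurable => // y z yz; apply: tail_anti; lra.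
by move=> y _; rewrite ger0_norm ?tail_ge0 ?tail_le1.
Qed.

Lemma integrable_cst r A c : r.-integrable `[- A, A] (EFin \o (fun=> c : R)).
Proof. exact: (integrable_trunc _ _ _ `|c|). Qed.

Lemma integrable_exp r A (g : R) : 0 <= g ->
  r.-integrable `[- A, A] (EFin \o (fun y => expR (g * y))).
Proof.
move=> g0; apply: (integrable_trunc _ _ _ (expR (g * A))).
  by apply: measurableT_comp => //; exact: measurable_funM.
move=> y /andP[_ yA]; rewrite ger0_norm ?expR_ge0// ler_expR.
by rewrite ler_wpM2l.
Qed.

Lemma integrable_lin r A (f g : R -> R) (c d : R) :
  r.-integrable `[- A, A] (EFin \o f) -> r.-integrable `[- A, A] (EFin \o g) ->
  r.-integrable `[- A, A] (EFin \o (fun y => c * f y + d * g y)).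
Proof.
move=> fi gi; rewrite (_ : _ \o _ = (fun y => c%:E * (EFin \o f) y + d%:E * (EFin \o g) y)%E)//.
by apply: integrableD => //; exact: integrableZl.
Qed.

Lemma Rintegral_lin r A (f g : R -> R) (c d : R) :
  r.-integrable `[- A, A] (EFin \o f) -> r.-integrable `[- A, A] (EFin \o g) ->
  \int[r]_(y in `[- A, A]) (c * f y + d * g y) =
  c * \int[r]_(y in `[- A, A]) f y + d * \int[r]_(y in `[- A, A]) g y.
Proof.
move=> fi gi; rewrite RintegralD//= ?RintegralZl//.
  exact: (integrableZl _ c fi).
exact: (integrableZl _ d gi).
Qed.

Lemma Rintegral_trunc_cst r A (c : R) : 0 <= c ->
  \int[r]_(y in `[- A, A]) c <= c.
Proof.
move=> c0; rewrite Rintegral_cst// ler_piMr// -lee_fin fineK; last exact: fin_num_measure.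
exact: probability_le1.
Qed.

Lemma one_jump_ge0 m r A x : 0 <= one_jump m r A x.
Proof. by apply: Rintegral_ge0 => y _; exact: tail_ge0. Qed.

(** A pointwise additive error d is paid at most once after integration, because the window has mass
    at most 1. *)
Lemma one_jump_le m r A x x' c d : 0 <= d ->
  (forall y, - A <= y <= A -> tail m (x' - y) <= c * tail m (x - y) + d) ->
  one_jump m r A x' <= c * one_jump m r A x + d.
Proof.
move=> d0 h; have it := integrable_tail m r A.
apply: le_trans (_ : c * one_jump m r A x + d * \int[r]_(y in `[- A, A]) 1 <= _).
  rewrite -Rintegral_lin//; last exact: integrable_cst.
  apply: le_Rintegral => //; first by apply: integrable_lin => //; exact: integrable_cst.
  by move=> y /=; rewrite in_itv/= mulr1 => /h.
by rewrite lerD2l ler_piMr// Rintegral_trunc_cst.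
Qed.

Lemma one_jump_le_tail m r A x : 0 <= A -> one_jump m r A x <= tail m (x - A).
Proof.
move=> A0; apply: le_trans (Rintegral_trunc_cst r A _ (tail_ge0 _ _)).
apply: le_Rintegral => //; [exact: integrable_tail|exact: integrable_cst|].
by move=> y /=; rewrite in_itv/= => /andP[_ yA]; apply: tail_anti; lra.
Qed.

(** Truncation keeps the exponential moment finite before anything is known about [mgf]. *)
Definition trunc_mgf r (g A : R) := \int[r]_(y in `[- A, A]) expR (g * y).

Lemma one_jump_le_mgf m r g A x d : 0 <= g -> 0 <= d ->
  (forall y, - A <= y <= A -> tail m (x - y) <= expR (g * y) * tail m x + d) ->
  one_jump m r A x <= trunc_mgf r g A * tail m x + d.
Proof.
move=> g0 d0 h; have ie := integrable_exp r A _ g0; have ic := integrable_cst r A 1.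
apply: le_trans (_ : tail m x * trunc_mgf r g A + d * \int[r]_(y in `[- A, A]) 1 <= _).
  rewrite -Rintegral_lin//.
  apply: le_Rintegral => //; [exact: integrable_tail|exact: integrable_lin|].
  by move=> y /=; rewrite in_itv/= mulr1 mulrC => /h.
by rewrite mulrC lerD2l ler_piMr// Rintegral_trunc_cst.
Qed.

Lemma one_jump_ge_mgf m r g A x d : 0 <= g -> 0 <= d ->
  (forall y, - A <= y <= A -> expR (g * y) * tail m x <= tail m (x - y) + d) ->
  trunc_mgf r g A * tail m x <= one_jump m r A x + d.
Proof.
move=> g0 d0 h; have ie := integrable_exp r A _ g0; have ic := integrable_cst r A 1.
have it := integrable_tail m r A.
apply: le_trans (_ : 1 * one_jump m r A x + d * \int[r]_(y in `[- A, A]) 1 <= _).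
  rewrite mulrC -RintegralZl// -Rintegral_lin//.
  apply: le_Rintegral => //; [|exact: integrable_lin|].
    exact: (integrableZl _ (tail m x) ie).
  by move=> y /=; rewrite in_itv/= mul1r mulr1 mulrC => /h.
by rewrite mul1r lerD2l ler_piMr// Rintegral_trunc_cst.
Qed.

(* The term [b] collects the contribution of the compact set [- A0, A0] only,
   while the error [d] is paid on the whole of [- A, A]. *)
Lemma one_jump_gap m r A0 A x x' c b d : 0 <= d -> A0 <= A ->
  (forall y, - A <= y <= A -> tail m (x' - y) <= c * tail m (x - y) + d) ->
  (forall y, - A0 <= y <= A0 -> tail m (x' - y) + b <= c * tail m (x - y) + d) ->
  one_jump m r A x' + b * fine (r `[- A0, A0]%classic) <= c * one_jump m r A x + d.
Proof.
move=> d0 AA h h0; have ic := integrable_cst r A 1; have it := integrable_tail m r A.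
have i1 : r.-integrable `[- A, A] (EFin \o \1_(`[- A0, A0]%classic)).
  apply: (integrable_trunc _ _ _ 1) => //.
  by move=> y _; rewrite indicE; case: (_ \in _); rewrite ?normr1// normr0.
have -> : fine (r `[- A0, A0]%classic) = \int[r]_(y in `[- A, A]) \1_(`[- A0, A0]%classic) y.
  rewrite /Rintegral integral_indic//; congr (fine (r _)); apply/seteqP; split=> y /=.
    by rewrite !in_itv/=; lra.
  by case.
apply: le_trans (_ : c * one_jump m r A x + d * \int[r]_(y in `[- A, A]) 1 <= _).
  rewrite -[one_jump m r A x']mul1r -!Rintegral_lin//.
  apply: le_Rintegral => //; do ?exact: integrable_lin.
  move=> y /=; rewrite in_itv/= mul1r mulr1 indicE => /h hy.
  have [|_] := boolP (y \in _); last by rewrite mulr0 addr0.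
  by rewrite inE /= in_itv/= mulr1 => /h0.
by rewrite lerD2l ler_piMr// Rintegral_trunc_cst.
Qed.

Lemma trunc_mgfE r g A : 0 <= g ->
  (trunc_mgf r g A)%:E = (\int[r]_(y in `[(- A)%R, A]) (expR (g * y))%:E)%E.
Proof.
by move=> g0; rewrite fineK//; apply: integrable_fin_num => //; exact: integrable_exp.
Qed.

Lemma measurable_expRM (g : R) D : measurable_fun D (fun y => (expR (g * y))%:E).
Proof.
apply/measurable_EFinP; apply: measurable_funTS.
by apply: measurableT_comp => //; exact: measurable_funM.
Qed.

Lemma trunc_mgf_le r g A : 0 <= g -> ((trunc_mgf r g A)%:E <= mgf r g)%E.
Proof.
move=> g0; rewrite trunc_mgfE//; apply: ge0_subset_integral => //.
exact: measurable_expRM.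
Qed.

Lemma le_trunc_mgf r g A B : 0 <= g -> A <= B -> trunc_mgf r g A <= trunc_mgf r g B.
Proof.
move=> g0 AB; rewrite -lee_fin !trunc_mgfE//; apply: ge0_subset_integral => //.
- exact: measurable_expRM.
- by move=> y /=; rewrite !in_itv/=; lra.
Qed.

Lemma cvg_trunc_mgf r g : 0 <= g ->
  ((trunc_mgf r g n%:R)%:E @[n --> \oo] --> mgf r g)%E.
Proof.
move=> g0; under eq_fun do rewrite trunc_mgfE//.
have := @ge0_nondecreasing_set_cvg_integral _ _ _ (fun n : nat => `[- n%:R, n%:R]%classic : set R)
  (fun y : R => (expR (g * y))%:E) r.
rewrite (_ : \bigcup_i _ = setT); last first.
  apply/seteqP; split=> // y _; exists (Num.truncn `|y|).+1 => //=.
  by rewrite in_itv/= -ler_norml ltW// Num.Theory.truncnS_gt.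
apply => //.
- move=> i j ij; apply/subsetPset => y /=; rewrite !in_itv/=.
  have : i%:R <= j%:R :> R by rewrite ler_nat.
  lra.
- by move=> i; exact: measurable_expRM.
Qed.

Lemma mgf_lty r g C : 0 <= g -> (forall A, trunc_mgf r g A <= C) -> (mgf r g < +oo)%E.
Proof.
move=> g0 hC; apply: le_lt_trans (ltry C).
rewrite -(cvg_lim _ (cvg_trunc_mgf r g g0))//.
apply: lime_le; first by apply/cvg_ex; exists (mgf r g); exact: cvg_trunc_mgf.
by apply: nearW => n; rewrite lee_fin.
Qed.

Lemma trunc_mgf_near r g e : 0 <= g -> (mgf r g < +oo)%E -> 0 < e ->
  exists2 A0, 0 <= A0 & forall A, A0 <= A -> fine (mgf r g) - e <= trunc_mgf r g A <= fine (mgf r g).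
Proof.
move=> g0 fi e0; have mfin : mgf r g \is a fin_num.
  by rewrite ge0_fin_numE//; apply: integral_ge0 => y _; rewrite lee_fin expR_ge0.
have cv : ((trunc_mgf r g n%:R)%:E @[n --> \oo] --> (fine (mgf r g))%:E)%E.
  by rewrite (fineK mfin); exact: cvg_trunc_mgf.
move: cv => /fine_cvgP[_].
move=> /cvgrPdist_le/(_ _ e0)[N _ /(_ N (leqnn N))] /= hN.
exists N%:R => // A NA; apply/andP; split; last first.
  by rewrite -lee_fin (fineK mfin); exact: trunc_mgf_le.
apply: le_trans (le_trunc_mgf r g _ _ g0 NA).
by move: hN; rewrite ler_norml => /andP[]; lra.
Qed.

Lemma probability_itv_gt0 r : exists2 A0, 0 <= A0 & 0 < fine (r `[- A0, A0]%classic).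
Proof.
(* At exponent 0 the truncated moment is the mass of the window and the full moment is 1, so the
   convergence of truncated moments applies. *)
have m0 : (mgf r 0 = 1)%E.
  rewrite /mgf; under eq_integral do rewrite mul0r expR0.
  by rewrite integral_cst// mul1e; exact: probability_setT.
have fin0 : (mgf r 0 < +oo)%E by rewrite m0 ltry.
have half0 : 0 < 2^-1 :> R by lra.
have [A0 A00 /(_ _ (lexx _))/andP[+ _]] := trunc_mgf_near r 0 2^-1 (lexx _) fin0 half0.
rewrite m0 /= /trunc_mgf; under eq_Rintegral do rewrite mul0r expR0.
rewrite Rintegral_cst// mul1r => h; exists A0 => //; lra.
Qed.

Lemma trunc_mgf_gt0 r g : 0 <= g -> exists2 A, 0 <= A & 0 < trunc_mgf r g A.
Proof.
move=> g0; have [A A0 rA] := probability_itv_gt0 r; exists A => //.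
apply: lt_le_trans (_ : 0 < expR (- g * A) * fine (r `[- A, A]%classic)) _.
  by rewrite mulr_gt0// expR_gt0.
rewrite -Rintegral_cst//; apply: le_Rintegral => //.
- exact: integrable_cst.
- exact: integrable_exp.
- move=> y /=; rewrite in_itv/= => /andP[Ay _].
  by rewrite ler_expR mulNr -mulrN ler_wpM2l.
Qed.

Lemma mgf_gt0 r g : 0 <= g -> (mgf r g < +oo)%E -> 0 < fine (mgf r g).
Proof.
move=> g0 fi; have [A _ tA] := trunc_mgf_gt0 r g g0.
rewrite fine_gt0// fi andbT (lt_le_trans _ (trunc_mgf_le r g A g0))//.
Qed.

End TruncatedIntegrals.

(** * Asymptotic inequalities at infinity *)

Section NearInfinity.
Context {R : realType}.
Implicit Types (f h F G N : R -> R) (P : R -> Prop).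

(** Shifts bounded below keep the argument large, so one threshold serves them all. *)
Lemma near_shift P A : (\forall x \near +oo, P x) ->
  \forall x \near +oo, forall y, - A <= y -> P (x + y).
Proof.
case=> M [Mr hM]; exists (M + A); split; first exact: num_real.
by move=> x Mx y Ay; apply: hM; lra.
Qed.

Lemma asym_eq_near f h e : asym_eq f h -> (\forall x \near +oo, 0 < h x) -> 0 < e ->
  \forall x \near +oo, (1 - e) * h x <= f x <= (1 + e) * h x.
Proof.
move=> /cvgrPdist_le fh h0 e0; have fe := fh _ e0.
near=> x.
have hx : 0 < h x by near: x.
have : `|1 - f x / h x| <= e by near: x.
rewrite ler_distlC => /andP[].
by rewrite ler_pdivlMr// ler_pdivrMr// => -> ->.
Unshelve. all: by end_near. Qed.

Lemma near_asym_eq f h : (\forall x \near +oo, 0 < h x) ->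
  (forall e, 0 < e -> \forall x \near +oo, (1 - e) * h x <= f x <= (1 + e) * h x) ->
  asym_eq f h.
Proof.
move=> h0 fh; apply/cvgrPdist_le => e e0; have fe := fh _ e0.
near=> x.
have hx : 0 < h x by near: x.
have /andP[f1 f2] : (1 - e) * h x <= f x <= (1 + e) * h x by near: x.
by rewrite ler_distlC ler_pdivlMr// ler_pdivrMr// f1 f2.
Unshelve. all: by end_near. Qed.

(** This is F <= G + o(N). The additive error survives sums and one-jump integrals, and makes sense
    even where F or G vanishes. *)
Definition le_near N F G := forall e, 0 < e ->
  \forall x \near +oo, F x <= G x + e * N x.

Definition shift_le g N G t := le_near N (fun x => G (x + t)) (fun x => expR (- g * t) * G x).

(* Monotonicity of [G] reduces uniformity on [a, b] to a finite grid of shifts. *)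
Lemma shift_le_unif g G N C a b e : 0 < g -> (forall x, 0 <= G x) -> (forall x, 0 <= N x) ->
  (forall x y, x <= y -> G y <= G x) -> 0 <= C -> (forall x, G x <= C * N x) ->
  (forall t, a <= t <= b -> shift_le g N G t) -> 0 < e ->
  \forall x \near +oo, forall t, a <= t <= b ->
    G (x + t) <= expR (- g * t) * G x + e * N x.
Proof.
move=> g0 G0 N0 Gd C0 GC sG e0.
(* The mesh d satisfies exp(g d) = 1 + k, so replacing t by the grid point below it costs a factor 1
   + k; k is chosen so that the resulting excess, at most k exp(- g a) C N, stays below e / 2 N. *)
pose D := expR (- g * a) * C + 1.
have D0 : 0 < D by rewrite ltr_wpDl// mulr_ge0// expR_ge0.
pose k := e / 2 / D.
have k0 : 0 < k by rewrite !divr_gt0.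
pose d := ln (1 + k) / g.
have gd : expR (g * d) = 1 + k.
  by rewrite /d mulrCA divff ?gt_eqF// mulr1 lnK// posrE; lra.
have d0 : 0 < d by rewrite divr_gt0// ln_gt0//; lra.
suff H (K : nat) : \forall x \near +oo, forall t, a <= t <= b -> t <= a + K%:R * d ->
    G (x + t) <= expR (- g * t) * G x + e * N x.
  have := H (Num.truncn `|(b - a) / d|).+1; apply: filterS => x hx t /andP[at_ tb].
  apply: hx; first by rewrite at_.
  rewrite -lerBlDl (le_trans (lerB tb (lexx a)))// -ler_pdivrMr//.
  by rewrite (le_trans (ler_norm _))// ltW// Num.Theory.truncnS_gt.
elim: K => [|K IH].
  have [ab|ab] := leP a b.
    have := sG a; rewrite lexx ab => /(_ isT _ e0); apply: filterS => x hx t tab ta.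
    suff -> : t = a by [].
    by apply/eqP; rewrite eq_le; apply/andP; split; lra.
  by apply: nearW => x t /andP[a1 a2]; lra.
set s := a + K%:R * d in IH *.
have as_ : a <= s by rewrite lerDl mulr_ge0// ltW.
have [sb|sb] := leP s b; last first.
  by apply: filterS IH => x IH t tab _; apply: IH => //; lra.
have e2 : 0 < e / 2 by lra.
have := sG s; rewrite as_ sb => /(_ isT _ e2) hs; near=> x => t tab tK.
have [ts|st] := leP t s.
  by move: t tab {tK} ts; near: x.
have xs : G (x + s) <= expR (- g * s) * G x + e / 2 * N x by near: x.
have xt : G (x + t) <= G (x + s) by apply: Gd; lra.
have E : expR (- g * s) <= expR (- g * t) * (1 + k).
  rewrite -gd -expRD ler_expR.
  have : t - s <= d by move: tK; rewrite -natr1 mulrDl mul1r /s; lra.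
  by rewrite -(ler_pM2l g0); lra.
have E2 : expR (- g * s) * G x <= expR (- g * t) * (1 + k) * G x by rewrite ler_wpM2r.
suff : expR (- g * t) * k * G x <= e / 2 * N x by lra.
apply: le_trans (_ : expR (- g * a) * k * (C * N x) <= _).
  apply: ler_pM => //; first by rewrite mulr_ge0 ?expR_ge0// ltW.
  apply: ler_wpM2r; first exact: ltW.
  by rewrite ler_expR !mulNr lerN2 ler_pM2l//; lra.
rewrite (_ : expR _ * _ * _ = k * (expR (- g * a) * C) * N x); last by ring.
rewrite ler_wpM2r// /k mulrAC ler_pdivrMr// ler_pM2l//.
by rewrite /D; lra.
Unshelve. all: by end_near. Qed.

End NearInfinity.

(** * One-sided description of L(gamma) *)

Section ExponentialTails.
Context {R : realType}.
Variables (g : R) (g0 : 0 < g).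
Implicit Types m r : probability R R.

(** Upper bounds for all shifts suffice: the lower bound for the shift t is the upper bound for the
    shift - t, read at x + t. *)
Lemma classLgammaP m : classLgamma g m <->
  (forall x, 0 < tail m x) /\ (forall t, shift_le g (tail m) (tail m) t).
Proof.
split=> -[m0 mL]; split=> // t.
  move=> e e0; have ee : 0 < e / expR (- g * t) by rewrite divr_gt0// expR_gt0.
  have pos : \forall x \near +oo, 0 < expR (- g * t) * tail m x.
    by apply: nearW => x; rewrite mulr_gt0// expR_gt0.
  have := asym_eq_near _ _ _ (mL t) pos ee; apply: filterS => x /andP[_].
  rewrite mulrDl mul1r (mulrA (e / _)) divfK//.
  by rewrite gt_eqF// expR_gt0.
apply: near_asym_eq; first by apply: nearW => x; rewrite mulr_gt0// expR_gt0.
move=> e e0.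
have e1 : 0 < e * expR (- g * t) by rewrite mulr_gt0// expR_gt0.
have e2 : 0 < e * expR (g * t) by rewrite mulr_gt0// expR_gt0.
have h1 := mL t _ e1; have /(near_shift _ (- t)) h2 := mL (- t) _ e2.
near=> x; apply/andP; split; last first.
  have : tail m (x + t) <= expR (- g * t) * tail m x + e * expR (- g * t) * tail m x by near: x.
  lra.
have : tail m (x + t - t) <= expR (- g * - t) * tail m (x + t) + e * expR (g * t) * tail m (x + t).
  have : forall y, - - t <= y -> tail m (x + y - t) <= expR (- g * - t) * tail m (x + y) + e * expR (g * t) * tail m (x + y) by near: x.
  by apply; rewrite opprK.
rewrite addrK mulrNN => h.
have E : expR (- g * t) * expR (g * t) = 1 by rewrite -expRD mulNr addNr expR0.
have := ler_wpM2l (expR_ge0 (- g * t)) h.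
rewrite mulrDr !mulrA E mul1r (mulrAC _ e) E mul1r => h'.
(* For e >= 1 the lower bound is trivial; otherwise (1 - e) (1 + e) <= 1 turns the factor 1 + e
   around. *)
have [le1|le1] := leP 1 e.
  have : 0 <= tail m (x + t) by exact: tail_ge0.
  apply: le_trans; rewrite -mulrA; apply: mulr_le0_ge0; first lra.
  by rewrite mulr_ge0 ?expR_ge0 ?tail_ge0.
have e1' : 0 <= 1 - e by lra.
have := ler_wpM2l e1' h'; have := tail_ge0 m (x + t).
have := mulr_ge0 (sqr_ge0 e) (tail_ge0 m (x + t)); rewrite expr2; nra.
Unshelve. all: by end_near. Qed.

End ExponentialTails.

(** * One-jump integrals of tails in L(gamma) *)

Section RegularOneJump.
Context {R : realType}.
Variables (g : R) (g0 : 0 < g).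
Implicit Types m r : probability R R.

Lemma classLgamma_unif m A e : classLgamma g m -> 0 <= A -> 0 < e ->
  \forall x \near +oo, forall y, - A <= y <= A ->
    tail m (x - y) <= expR (g * y) * tail m x + e * tail m x /\
    expR (g * y) * tail m x <= tail m (x - y) + e * tail m x.
Proof.
move=> /(classLgammaP _ _).1 [m0 mL] A0 e0.
have U e' : 0 < e' -> \forall x \near +oo, forall t, - A <= t <= A ->
    tail m (x + t) <= expR (- g * t) * tail m x + e' * tail m x.
  move=> e'0; apply: (@shift_le_unif _ g (tail m) (tail m) 1) => //.
  - exact: tail_ge0.
  - exact: tail_ge0.
  - exact: tail_anti.
  - by move=> x; rewrite mul1r.
have eA : expR (g * A) > 0 by exact: expR_gt0.
(* The lower bound comes from the upper one at x - y. Its error is multiplied by exp(g y) <= exp(g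
   A), and the tail at x - y is at most exp(g A) + 1 times the tail at x; e' compensates both
   factors. *)
pose e' := e / (expR (g * A) * (expR (g * A) + 1)).
have D0 : 0 < expR (g * A) * (expR (g * A) + 1) by rewrite mulr_gt0// ltr_wpDl// ltW.
have e'0 : 0 < e' by rewrite divr_gt0.
have U1 := U _ ltr01; have Ue := U _ e0; have /(near_shift _ A) Ue' := U _ e'0.
near=> x => y /andP[Ay yA]; split.
  have : forall t, - A <= t <= A ->
    tail m (x + t) <= expR (- g * t) * tail m x + e * tail m x by near: x.
  by move=> /(_ (- y)); rewrite mulrNN; apply; lra.
have : forall z, - A <= z -> forall t, - A <= t <= A ->
    tail m (x + z + t) <= expR (- g * t) * tail m (x + z) + e' * tail m (x + z) by near: x.
move=> /(_ (- y) _ y); rewrite subrK => h.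
have {}h : tail m x <= expR (- g * y) * tail m (x - y) + e' * tail m (x - y).
  by apply: h; lra.
have : forall t, - A <= t <= A ->
    tail m (x + t) <= expR (- g * t) * tail m x + 1 * tail m x by near: x.
move=> /(_ (- A)); rewrite mulrNN mul1r => hA.
have {}hA : tail m (x - y) <= (expR (g * A) + 1) * tail m x.
  rewrite mulrDl mul1r; apply: le_trans (hA _); last by lra.
  by apply: tail_anti; lra.
have E : expR (g * y) * expR (- g * y) = 1 by rewrite -expRD mulNr addrN expR0.
have := ler_wpM2l (expR_ge0 (g * y)) h.
rewrite mulrDr (mulrA (expR _) (expR _)) E mul1r => /le_trans; apply; rewrite lerD2l.
have t0 := tail_ge0 m (x - y).
apply: le_trans (_ : expR (g * A) * (e' * ((expR (g * A) + 1) * tail m x)) <= _).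
  apply: ler_pM; first exact: expR_ge0.
  - by apply: mulr_ge0 => //; exact: ltW.
  - by rewrite ler_expR ler_pM2l.
  - by rewrite ler_pM2l.
rewrite le_eqVlt; apply/orP; left; apply/eqP.
by rewrite /e'; field; rewrite !gt_eqF// ltr_wpDl// ltW.
Unshelve. all: by end_near. Qed.

Lemma one_jump_asym m r A e : classLgamma g m -> 0 <= A -> 0 < e ->
  \forall x \near +oo,
    (trunc_mgf r g A - e) * tail m x <= one_jump m r A x <=
    (trunc_mgf r g A + e) * tail m x.
Proof.
move=> mL A0 e0; have := classLgamma_unif _ _ _ mL A0 e0.
apply: filterS => x h; have et : 0 <= e * tail m x by rewrite mulr_ge0 ?tail_ge0 ?ltW.
rewrite mulrBl mulrDl lerBlDr; apply/andP; split.
  by apply: one_jump_ge_mgf => //; [exact: ltW|move=> y /h[]].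
by apply: one_jump_le_mgf => //; [exact: ltW|move=> y /h[]].
Qed.

End RegularOneJump.

(** * Laws dominated by a convolution equivalent law *)

Section DominatedTails.
Context {R : realType}.
Variables (g : R) (g0 : 0 < g) (nu : probability R R) (nuS : classSgamma g nu).
Implicit Types m r : probability R R.
Local Notation N := (tail nu).

Let nuL : classLgamma g nu. Proof. by case: nuS. Qed.

Let N_gt0 x : 0 < N x. Proof. by case: nuL. Qed.

Let N_ge0 x : 0 <= N x. Proof. exact: tail_ge0. Qed.

Let M := fine (mgf nu g).

Lemma sum_tail_le_mgf e : 0 < e ->
  \forall x \near +oo, sum_tail nu nu x <= (2 * M + e) * N x.
Proof.
move=> e0; case: nuS => _ [fi nu2]; have M0 : 0 < M := mgf_gt0 _ _ (ltW g0) fi.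
have pos : \forall x \near +oo, 0 < 2 * M * N x.
  by apply: nearW => x; rewrite !mulr_gt0.
have e1 : 0 < e / (2 * M) by rewrite divr_gt0// mulr_gt0.
have := asym_eq_near _ _ _ nu2 pos e1; apply: filterS => x /andP[_].
by rewrite tail_conv mulrA mulrDl mul1r divfK// gt_eqF// mulr_gt0.
Qed.

(** The tail of nu * nu is about 2 M N, and each of the two one-jump integrals already accounts for
    nearly M N, which leaves only o(N) for two jumps. *)
Lemma two_jumps_small e : 0 < e -> exists2 A0, 0 <= A0 & forall A, A0 <= A ->
  \forall x \near +oo, two_jumps nu nu A x <= e * N x.
Proof.
(* One fifth is spent on the tail of nu * nu and two on each one-jump integral: truncation of the
   moment and asymptotics. *)
move=> e0; have e5 : 0 < e / 5 by lra.
have fi : (mgf nu g < +oo)%E by case: nuS => _ [].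
have [A0 A00 hA0] := trunc_mgf_near nu g _ (ltW g0) fi e5.
exists A0 => // A AA; have A_ge0 : 0 <= A by lra.
have /andP[mA _] := hA0 A AA.
have h1 := sum_tail_le_mgf _ e5; have h2 := one_jump_asym g g0 nu nu A _ nuL A_ge0 e5.
near=> x.
have x1 : sum_tail nu nu x <= (2 * M + e / 5) * N x by near: x.
have /andP[x2 _] : (trunc_mgf nu g A - e / 5) * N x <= one_jump nu nu A x <=
    (trunc_mgf nu g A + e / 5) * N x by near: x.
have x3 := sum_tail_ge nu nu A x A_ge0.
have {}x3 : one_jump nu nu A x + one_jump nu nu A x + two_jumps nu nu A x <= sum_tail nu nu x.
  by apply: x3; near: x; apply: nbhs_pinfty_ge; exact: num_real.
have : (M - e / 5 - e / 5) * N x <= one_jump nu nu A x.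
  by apply: le_trans x2; rewrite ler_wpM2r// lerD2r.
lra.
Unshelve. all: by end_near. Qed.

(** The bound is required at every x, since integrating sections evaluates tails everywhere. *)
Definition dominated m := exists2 C, 0 <= C & forall x, tail m x <= C * N x.

Lemma dominated_near m C : (\forall x \near +oo, tail m x <= C * N x) -> dominated m.
Proof.
(* Up to B the tail is at most 1 while N is at least N (B + 1) > 0; the maximum covers a negative
   C. *)
case=> B [_ hB]; exists (Num.max C 0 + (N (B + 1))^-1).
  by rewrite addr_ge0 ?le_max ?lexx ?orbT// invr_ge0.
move=> x; rewrite mulrDl; have [Bx|xB] := ltP B x.
  rewrite (le_trans (hB _ Bx))// (le_trans (_ : _ <= Num.max C 0 * N x))//.
    by rewrite ler_wpM2r// le_max lexx.
  by rewrite lerDl mulr_ge0// invr_ge0.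
rewrite (le_trans (tail_le1 _ _))// (le_trans (_ : _ <= (N (B + 1))^-1 * N x))//.
  by rewrite mulrC ler_pdivlMr// mul1r tail_anti//; lra.
by rewrite lerDr mulr_ge0// le_max lexx orbT.
Qed.

Lemma N_shift A : \forall x \near +oo, N (x + A) <= (expR (- g * A) + 1) * N x.
Proof.
have [_ /(_ A 1 ltr01)] := (classLgammaP _ _).1 nuL.
by apply: filterS => x; rewrite mulrDl.
Qed.

Lemma dominated_conv m r (s : probability R R) : dominated m -> dominated r ->
  (forall x, tail s x = sum_tail m r x) -> dominated s.
Proof.
move=> [C C0 mC] [D D0 rD] sE; apply: (dominated_near _ (C * D * (2 * M + 1))).
have := sum_tail_le_mgf _ ltr01; apply: filterS => x hx.
rewrite sE (le_trans (sum_tail_dom _ _ _ _ _ x C0 D0 mC rD))//.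
by have := ler_wpM2l (mulr_ge0 C0 D0) hx; rewrite mulrA.
Qed.

(** Domination transfers the negligibility of two jumps from nu. The remaining tails at x + A are
    bounded by multiples of N (x + A), which is small relative to N x because g > 0 and A is
    large. *)
Lemma sum_tail_near m r e : dominated m -> dominated r -> 0 < e ->
  exists2 A0, 0 <= A0 & forall A, A0 <= A -> \forall x \near +oo,
    sum_tail m r x <= one_jump m r A x + one_jump r m A x + e * N x.
Proof.
move=> [C C0 mC] [D D0 rD] e0.
(* C * D weighs the two-jump term; 2 * C and 2 * D weigh the tails at x + A, where N (x + A) <= 2 *
   (e / K * N x). *)
pose K := C * D + 2 * C + 2 * D + 1.
have CD0 : 0 <= C * D by rewrite mulr_ge0.
have K0 : 0 < K by rewrite /K; lra.
have eK : 0 < e / K by rewrite divr_gt0.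
have [A0 A00 hA0] := two_jumps_small _ eK.
pose A1 := Num.max A0 (Num.max 0 (- ln (e / K) / g)).
exists A1; first by rewrite le_max A00.
move=> A AA; have [AA0 [A_ge0 AK]] : A0 <= A /\ 0 <= A /\ - ln (e / K) / g <= A.
  by move: AA; rewrite /A1 !ge_max => /andP[-> /andP[-> ->]].
have eA : expR (- g * A) <= e / K.
  rewrite -[leRHS]lnK ?posrE// ler_expR mulNr lerNl (mulrC g).
  by rewrite -ler_pdivrMr.
have [_ /(_ A _ eK) hN] := (classLgammaP _ _).1 nuL; have hJ := hA0 A AA0.
near=> x.
have xJ : two_jumps nu nu A x <= e / K * N x by near: x.
have xN : N (x + A) <= expR (- g * A) * N x + e / K * N x by near: x.
have {}xN : N (x + A) <= 2 * (e / K * N x).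
  have : expR (- g * A) * N x <= e / K * N x by rewrite ler_wpM2r.
  lra.
have s1 := sum_tail_le m r A x A_ge0.
have s2 := two_jumps_dom _ _ _ _ _ A x C0 D0 mC rD.
have s3 := ler_wpM2l CD0 xJ.
have s4 := ler_wpM2l C0 xN; have s5 := ler_wpM2l D0 xN.
have s6 := mC (x + A); have s7 := rD (x + A).
have -> : e * N x = K * (e / K * N x) by rewrite mulrA (mulrC K) divfK// gt_eqF.
have := mulr_ge0 (ltW eK) (N_ge0 x); rewrite /K; lra.
Unshelve. all: by end_near. Qed.

(** After multiplication by exp(g x), the tail of m decreases up to o(exp(g x) N(x)). *)
Definition asym_decreasing m := forall t, 0 <= t -> shift_le g N (tail m) t.

(** The shift t is fixed and only the base point x - y moves, so uniformity in y costs just the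
    factor K between N (x - A) and N x. *)
Lemma asym_decreasing_near m A t e : asym_decreasing m -> 0 <= t -> 0 < e ->
  \forall x \near +oo, forall y, - A <= y <= A ->
    tail m (x + t - y) <= expR (- g * t) * tail m (x - y) + e * N x.
Proof.
move=> mD t0 e0; pose K := expR (- g * - A) + 1.
have K0 : 0 < K by rewrite ltr_wpDl// expR_ge0.
have eK : 0 < e / K by rewrite divr_gt0.
have /(near_shift _ A) h := mD t t0 _ eK; have hN := N_shift (- A).
near=> x => y /andP[Ay yA].
have hx : forall y, - A <= y ->
  tail m (x + y + t) <= expR (- g * t) * tail m (x + y) + e / K * N (x + y) by near: x.
have xN : N (x - A) <= K * N x by near: x.
rewrite addrAC (le_trans (hx (- y) _)) ?lerN2// lerD2l.
apply: le_trans (_ : e / K * (K * N x) <= _); last by rewrite mulrA divfK// gt_eqF.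
rewrite ler_pM2l// (le_trans _ xN)// tail_anti//; lra.
Unshelve. all: by end_near. Qed.

Lemma one_jump_decreasing m r A t : asym_decreasing m -> 0 <= t ->
  le_near N (fun x => one_jump m r A (x + t))
            (fun x => expR (- g * t) * one_jump m r A x).
Proof.
move=> mD t0 e e0; have := asym_decreasing_near _ A _ _ mD t0 e0.
by apply: filterS => x hx; apply: one_jump_le => //; rewrite mulr_ge0// ltW.
Qed.

(** The one-jump decomposition is used as an upper bound at x + t and, without its two-jump term, as
    a lower bound at x; each one-jump integral inherits the monotonicity. *)
Lemma asym_decreasing_conv m r (s : probability R R) :
  dominated m -> dominated r -> asym_decreasing m -> asym_decreasing r ->
  (forall x, tail s x = sum_tail m r x) -> asym_decreasing s.
Proof.
move=> md rd mD rD sE t t0 e e0; have e3 : 0 < e / 3 by lra.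
have [A A0 /(_ A (lexx _))/(near_shift _ 0) hA] := sum_tail_near _ _ _ md rd e3.
have h1 := one_jump_decreasing _ r A _ mD t0 _ e3.
have h2 := one_jump_decreasing _ m A _ rD t0 _ e3.
near=> x; rewrite !sE.
have xA : forall y, - 0 <= y -> sum_tail m r (x + y) <=
  one_jump m r A (x + y) + one_jump r m A (x + y) + e / 3 * N (x + y) by near: x.
have {}xA := xA t; rewrite oppr0 in xA; have {}xA := xA t0.
have x1 : one_jump m r A (x + t) <= expR (- g * t) * one_jump m r A x + e / 3 * N x by near: x.
have x2 : one_jump r m A (x + t) <= expR (- g * t) * one_jump r m A x + e / 3 * N x by near: x.
have x3 : one_jump m r A x + one_jump r m A x + two_jumps m r A x <= sum_tail m r x.
  by apply: sum_tail_ge => //; near: x; apply: nbhs_pinfty_ge; exact: num_real.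
have J0 : 0 <= two_jumps m r A x by exact: joint_ge0.
have xN : e / 3 * N (x + t) <= e / 3 * N x by rewrite ler_pM2l// tail_anti// lerDl.
have := ler_wpM2l (expR_ge0 (- g * t)) x3; have := mulr_ge0 (expR_ge0 (- g * t)) J0.
lra.
Unshelve. all: by end_near. Qed.

Lemma asym_decreasing_unif m A e : dominated m -> asym_decreasing m -> 0 <= A -> 0 < e ->
  \forall x \near +oo, forall t, 0 <= t <= A ->
    tail m (x + t) <= expR (- g * t) * tail m x + e * N x.
Proof.
move=> [C C0 mC] mD A0 e0; apply: (@shift_le_unif _ g (tail m) N C) => //.
- exact: tail_ge0.
- exact: tail_anti.
- by move=> t /andP[t0 _]; exact: mD.
Qed.

(** The reverse of [asym_decreasing]; together they give m-bar(x + s) = exp(- g s) m-bar(x) +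
    o(N(x)). *)
Definition asym_increasing m := forall s, 0 <= s ->
  le_near N (fun x => expR (- g * s) * tail m x) (fun x => tail m (x + s)).

(* Since exp(g x) N(x) is asymptotically constant, no asymptotically decreasing summand of
   it can lose a positive fraction of N over a bounded shift: on the compact set [- A0, A0],
   which has positive mass, such a loss would show up in the one-jump integral. *)
Lemma asym_increasing_factor m r : dominated m -> dominated r ->
  asym_decreasing m -> asym_decreasing r ->
  (forall x, N x = sum_tail m r x) -> asym_increasing m.
Proof.
move=> md rd mD rD NE s s0 e e0.
have [A0 A00 p0] := probability_itv_gt0 r; set p := fine _ in p0.
pose K := expR (- g * - A0) + 1.
have K0 : 0 < K by rewrite ltr_wpDl// expR_ge0.
have E0 : 0 < expR (- g * (2 * A0)) by exact: expR_gt0.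
(* Four errors e1 * N x will accumulate, and N x <= K * N (x + A0); the other factors are the mass p
   of the window and the discount of the loss D below. *)
pose e1 := e * p * expR (- g * (2 * A0)) / (4 * K).
have e10 : 0 < e1 by rewrite divr_gt0 ?mulr_gt0.
have e20 : 0 < e1 / (K + 1) by rewrite divr_gt0// addr_gt0.
have [A1 A10 /(_ (Num.max A0 A1))] := sum_tail_near _ _ _ md rd e10.
set A := Num.max A0 A1 => hA.
have A1A : A1 <= A by rewrite le_max lexx orbT.
have A0A : A0 <= A by rewrite le_max lexx.
have A_ge0 : 0 <= A by lra.
(* With this t, for every y in [- A0, A0] the interval from x - y to x + t - y contains
   [x + A0, x + A0 + s], so a loss there is seen from the whole window. *)
pose t := s + 2 * A0; have t0 : 0 <= t by rewrite /t; lra.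
have h1 := classLgamma_unif _ g0 _ _ _ nuL t0 e10.
have /(near_shift _ 0) h2 := hA A1A.
have h3 := one_jump_decreasing _ m A _ rD t0 _ e10.
have h4 := asym_decreasing_near _ A _ _ mD t0 e10.
have AA0 : 0 <= 2 * A0 by lra.
have /(near_shift _ A0) h5 := asym_decreasing_unif _ _ _ md mD AA0 e20.
have h6 := N_shift (- A0).
have /(near_shift _ (- A0)) h7 := h6.
suff : \forall x \near +oo, expR (- g * s) * tail m (x + A0) <= tail m (x + A0 + s) + e * N (x + A0).
  move=> /(near_shift _ A0); apply: filterS => x /(_ (- A0)).
  by rewrite subrK; apply.
near=> x.
have x1 : expR (- g * t) * N x <= N (x + t) + e1 * N x.
  have : forall y, - t <= y <= t -> N (x - y) <= expR (g * y) * N x + e1 * N x /\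
    expR (g * y) * N x <= N (x - y) + e1 * N x by near: x.
  by move=> /(_ (- t)) []; [lra|rewrite opprK mulrN -mulNr].
have x2 : N (x + t) <= one_jump m r A (x + t) + one_jump r m A (x + t) + e1 * N (x + t).
  rewrite {1}NE.
  have : forall y, - 0 <= y -> sum_tail m r (x + y) <= one_jump m r A (x + y) +
    one_jump r m A (x + y) + e1 * N (x + y) by near: x.
  by apply; rewrite oppr0.
have {}x2 : N (x + t) <= one_jump m r A (x + t) + one_jump r m A (x + t) + e1 * N x.
  by apply: (le_trans x2); rewrite lerD2l ler_pM2l// tail_anti// lerDl.
have x3 : one_jump r m A (x + t) <= expR (- g * t) * one_jump r m A x + e1 * N x by near: x.
have x4 : one_jump m r A x + one_jump r m A x <= N x.
  have Ax : 2 * A <= x by near: x; apply: nbhs_pinfty_ge; exact: num_real.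
  by rewrite NE; apply: le_trans (sum_tail_ge m r A x A_ge0 Ax); rewrite lerDl joint_ge0.
have := ler_wpM2l (expR_ge0 (- g * t)) x4; rewrite mulrDr => {}x4.
have x5 : expR (- g * t) * one_jump m r A x <= one_jump m r A (x + t) + 3 * (e1 * N x) by lra.
have x6 : forall y, - A <= y <= A ->
    tail m (x + t - y) <= expR (- g * t) * tail m (x - y) + e1 * N x by near: x.
have xN : N (x - A0) <= K * N x by near: x.
have xN' : N x <= K * N (x + A0).
  have : forall y, - - A0 <= y -> N (x + y - A0) <= K * N (x + y) by near: x.
  by move=> /(_ A0); rewrite opprK addrK; apply.
have x7 : forall z, - A0 <= z -> forall u, 0 <= u <= 2 * A0 ->
    tail m (x + z + u) <= expR (- g * u) * tail m (x + z) + e1 / (K + 1) * N (x + z) by near: x.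
(* D is the loss to be bounded. Passing from x - y to x + t - y in steps A0 + y, s and A0 - y shows
   that it persists up to the factor exp(- g (2 A0)). *)
set D := expR (- g * s) * tail m (x + A0) - tail m (x + A0 + s).
suff : D <= e * N (x + A0) by rewrite /D; lra.
have [D0|D0] := leP D 0; first by rewrite (le_trans D0)// mulr_ge0// ltW.
have x8 y : - A0 <= y <= A0 -> tail m (x + t - y) + expR (- g * (2 * A0)) * D <=
    expR (- g * t) * tail m (x - y) + e1 * N x.
  move=> yA.
  have a1 : tail m (x + A0) <= expR (- g * (A0 + y)) * tail m (x - y) + e1 / (K + 1) * (K * N x).
    have -> : x + A0 = x - y + (A0 + y) by ring.
    apply: le_trans (x7 (- y) _ (A0 + y) _) _; [lra|lra|].
    rewrite lerD2l ler_pM2l// (le_trans _ xN)// tail_anti//; lra.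
  have a2 : tail m (x + t - y) <= expR (- g * (A0 - y)) * tail m (x + A0 + s) + e1 / (K + 1) * N x.
    have -> : x + t - y = x + (A0 + s) + (A0 - y) by rewrite /t; ring.
    apply: le_trans (x7 (A0 + s) _ (A0 - y) _) _; [lra|lra|].
    rewrite addrA lerD2l ler_pM2l// tail_anti//; lra.
  have E1 : expR (- g * (A0 - y)) * expR (- g * s) * expR (- g * (A0 + y)) = expR (- g * t).
    by rewrite -!expRD; congr expR; rewrite /t; ring.
  have a3 := ler_wpM2l (expR_ge0 (- g * (A0 - y))) (ler_wpM2l (expR_ge0 (- g * s)) a1).
  have le1 u : 0 <= u -> expR (- g * u) <= 1.
    by move=> u0; rewrite -[leRHS]expR0 ler_expR mulNr oppr_le0 mulr_ge0// ltW.
  have a4 : expR (- g * (A0 - y)) * expR (- g * s) * (e1 / (K + 1) * (K * N x)) <= e1 / (K + 1) * (K * N x).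
    apply: ler_piMl; first by apply: mulr_ge0; [exact: ltW|apply: mulr_ge0 => //; exact: ltW].
    by rewrite -expRD -mulrDr le1//; lra.
  have a5 : expR (- g * (2 * A0)) * D <= expR (- g * (A0 - y)) * D.
    rewrite ler_pM2r// ler_expR !mulNr lerN2 ler_pM2l//; lra.
  have a6 : e1 / (K + 1) * (K * N x) + e1 / (K + 1) * N x = e1 * N x.
    by field; rewrite gt_eqF// addr_gt0.
  move: a2 a3 a4 a5 a6; rewrite -E1 /D; move: (e1 / (K + 1)) => q; lra.
have d0 : 0 <= e1 * N x by rewrite mulr_ge0// ltW.
have := one_jump_gap m r A0 A x (x + t) (expR (- g * t)) _ _ d0 A0A x6 x8.
rewrite -/p => x9.
have {x9 x5} x9 : expR (- g * (2 * A0)) * D * p <= 4 * (e1 * N x) by lra.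
have x10 : 4 * (e1 * N x) <= 4 * (e1 * (K * N (x + A0))) by rewrite !ler_pM2l.
have : expR (- g * (2 * A0)) * D * p <= expR (- g * (2 * A0)) * (e * N (x + A0)) * p.
  apply: (le_trans x9); apply: (le_trans x10); rewrite le_eqVlt; apply/orP; left; apply/eqP.
  by rewrite /e1; field; rewrite gt_eqF.
by rewrite ler_pM2r// ler_pM2l.
Unshelve. all: by end_near. Qed.

(** C may depend on e. For r = nu and e < 1 the term in N is absorbed on the left, giving N =
    O(m-bar). *)
Definition controlled m r := forall e, 0 < e -> exists2 C, 0 <= C &
  \forall x \near +oo, tail r x <= C * tail m x + e * N x.

(** Each one-jump integral is bounded crudely by a tail at x - A. Control of r reduces both to the
    tail of m at x - A, which [asym_increasing] brings back to x. *)
Lemma controlled_conv m r (s : probability R R) :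
  dominated m -> dominated r -> asym_increasing m -> controlled m r ->
  (forall x, tail s x = sum_tail m r x) -> controlled m s.
Proof.
move=> md rd mI mr sE e e0; have e4 : 0 < e / 4 by lra.
have [A A0 /(_ A (lexx _)) h1] := sum_tail_near _ _ _ md rd e4.
pose K := expR (- g * - A) + 1.
have K0 : 0 < K by rewrite ltr_wpDl// expR_ge0.
have eK : 0 < e / 4 / K by rewrite divr_gt0.
have [C C0 /(near_shift _ A) h2] := mr _ eK.
have E0 : 0 < expR (- g * A) by exact: expR_gt0.
have C10 : 0 < 1 + C by rewrite ltr_wpDr.
pose e' := e / 4 * expR (- g * A) / ((1 + C) * K).
have e'0 : 0 < e' by rewrite divr_gt0 ?mulr_gt0.
have /(near_shift _ A) h3 := mI A A0 _ e'0; have h4 := N_shift (- A).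
exists ((1 + C) / expR (- g * A)); first by rewrite divr_ge0 ?expR_ge0// ltW.
near=> x; rewrite sE.
have x1 : sum_tail m r x <= one_jump m r A x + one_jump r m A x + e / 4 * N x by near: x.
have x2 : tail r (x - A) <= C * tail m (x - A) + e / 4 / K * N (x - A).
  have : forall y, - A <= y -> tail r (x + y) <= C * tail m (x + y) + e / 4 / K * N (x + y) by near: x.
  exact.
have x3 : expR (- g * A) * tail m (x - A) <= tail m x + e' * N (x - A).
  have : forall y, - A <= y -> expR (- g * A) * tail m (x + y) <= tail m (x + y + A) + e' * N (x + y) by near: x.
  by move=> /(_ (- A)); rewrite subrK; apply.
have x4 : N (x - A) <= K * N x by near: x.
have {}x2 : tail r (x - A) <= C * tail m (x - A) + e / 4 * N x.
  apply: (le_trans x2); rewrite lerD2l -[leRHS](_ : e / 4 / K * (K * N x) = _) ?ler_pM2l//.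
  by field; rewrite gt_eqF.
have {}x3 : (1 + C) * tail m (x - A) <= (1 + C) / expR (- g * A) * tail m x + e / 4 * N x.
  have a1 : e' * N (x - A) <= e' * (K * N x) by rewrite ler_pM2l.
  have a2 : tail m (x - A) <= (expR (- g * A))^-1 * (tail m x + e' * (K * N x)).
    rewrite mulrC ler_pdivlMr// mulrC; lra.
  apply: (le_trans (ler_wpM2l (ltW C10) a2)).
  rewrite le_eqVlt; apply/orP; left; apply/eqP.
  by rewrite /e'; field; rewrite !gt_eqF.
have := one_jump_le_tail m r A x A0; have := one_jump_le_tail r m A x A0.
have := mulr_ge0 (ltW e0) (N_ge0 x); lra.
Unshelve. all: by end_near. Qed.

(** N (x - A) is at least a positive multiple of the tail of m at x, and N (x - A) = O(N x). *)
Lemma dominated_factor m r : (forall x, N x = sum_tail m r x) -> dominated m.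
Proof.
move=> NE; have [A0 A00 p0] := probability_itv_gt0 r.
(* The extra 1 places the closed window [- A0, A0] inside the open half-line above - A. *)
pose A := A0 + 1; have q0 : 0 < tail r (- A).
  apply: (lt_le_trans p0); rewrite /tail set_mem_set fine_le ?fin_num_measure//.
  by rewrite le_measure ?inE// => z /=; rewrite !in_itv/= andbT /A => /andP[]; lra.
pose K := expR (- g * - A) + 1.
apply: (dominated_near _ (K / tail r (- A))).
have := N_shift (- A); apply: filterS => x hx.
rewrite mulrAC ler_pdivlMr// (le_trans _ hx)// NE mulrC.
by have := sum_tail_ge_tail m r A (x - A); rewrite subrK.
Qed.

(** Once N = O(m-bar), every error o(N) is o(m-bar), so the additive estimates become asymptotic
    equivalences. *)
Lemma classSgamma_of_equiv m C : dominated m -> asym_decreasing m -> asym_increasing m ->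
  0 < C -> (\forall x \near +oo, N x <= C * tail m x) -> classSgamma g m.
Proof.
move=> md mD mI C0 NC.
have m0 x : 0 < tail m x.
  case: NC => B [_ hB]; apply: (@lt_le_trans _ _ (tail m (Num.max x (B + 1)))).
    have : B < Num.max x (B + 1) by rewrite lt_max; apply/orP; right; lra.
    by move=> /hB h; rewrite -(pmulr_rgt0 _ C0); exact: lt_le_trans h.
  by apply: tail_anti; rewrite le_max lexx.
have mL : classLgamma g m.
  apply/classLgammaP; split=> // t e e0.
  have [t0|/ltW t0] := leP 0 t.
    have eC : 0 < e / C by rewrite divr_gt0.
    have h1 := mD t t0 _ eC; near=> x.
    have x1 : tail m (x + t) <= expR (- g * t) * tail m x + e / C * N x by near: x.
    apply: (le_trans x1); rewrite lerD2l mulrAC ler_pdivrMr// -mulrA ler_pM2l// mulrC.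
    by near: x.
  (* A negative shift is handled by [asym_increasing] at the base point x + t. *)
  pose s := - t; have s0 : 0 <= s by rewrite oppr_ge0.
  pose K := expR (- g * t) + 1.
  have K0 : 0 < K by rewrite ltr_wpDl// expR_ge0.
  have E0 : 0 < expR (- g * t) by exact: expR_gt0.
  pose e' := e / (expR (- g * t) * K * C).
  have e'0 : 0 < e' by rewrite divr_gt0 ?mulr_gt0.
  have /(near_shift _ s) h1 := mI s s0 _ e'0; have h2 := N_shift t; near=> x.
  have x1 : expR (g * t) * tail m (x + t) <= tail m x + e' * N (x + t).
    have : forall y, - s <= y -> expR (- g * s) * tail m (x + y) <= tail m (x + y + s) + e' * N (x + y) by near: x.
    by move=> /(_ t); rewrite /s opprK addrK mulrNN; apply.
  have x2 : N (x + t) <= K * N x by near: x.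
  have x3 : N x <= C * tail m x by near: x.
  have x4 : e' * N (x + t) <= e' * (K * (C * tail m x)).
    by rewrite ler_pM2l// (le_trans x2)// ler_pM2l.
  have E : expR (- g * t) * expR (g * t) = 1 by rewrite -expRD mulNr addNr expR0.
  have := ler_wpM2l (ltW E0) (le_trans x1 (lerD (lexx _) x4)).
  rewrite mulrA E mul1r mulrDr => /le_trans; apply; rewrite lerD2l.
  rewrite le_eqVlt; apply/orP; left; apply/eqP.
  by rewrite /e'; field; rewrite !gt_eqF.
have [D D0 mDD] := md.
(* The one-jump integral of nu against m is about [trunc_mgf m g] times N, while the whole tail of
   nu * m is at most D * (2 * M + 1) * N; this bounds all truncated moments. *)
have fi : (mgf m g < +oo)%E.
  apply: (mgf_lty _ _ (1 + D * (2 * M + 1)) (ltW g0)) => A.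
  apply: le_trans (le_trunc_mgf m g A `|A| (ltW g0) (ler_norm _)) _.
  have h1 := one_jump_asym g g0 nu m `|A| 1 nuL (normr_ge0 _) ltr01.
  have h2 := sum_tail_le_mgf _ ltr01.
  suff : \forall x \near (+oo : set_system R), trunc_mgf m g `|A| <= 1 + D * (2 * M + 1).
    by move/filter_ex => [].
  near=> x.
  have /andP[x1 _] : (trunc_mgf m g `|A| - 1) * N x <= one_jump nu m `|A| x <=
    (trunc_mgf m g `|A| + 1) * N x by near: x.
  have x2 : sum_tail nu nu x <= (2 * M + 1) * N x by near: x.
  have Ax : 2 * `|A| <= x by near: x; apply: nbhs_pinfty_ge; exact: num_real.
  have x3 := sum_tail_ge nu m `|A| x (normr_ge0 _) Ax.
  have J0 : 0 <= two_jumps nu m `|A| x by exact: joint_ge0.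
  have x4 : sum_tail m nu x <= D * sum_tail nu nu x by exact: sum_tail_dom1.
  have x5 := one_jump_ge0 m nu `|A| x.
  have x6 := ler_wpM2l D0 x2.
  rewrite sum_tailC in x4.
  rewrite -lerBlDl -(ler_pM2r (N_gt0 x)); lra.
split=> //; split=> //.
have M0 := mgf_gt0 _ _ (ltW g0) fi; set Mm := fine _ in M0 *.
apply: near_asym_eq; first by apply: nearW => x; rewrite !mulr_gt0.
(* The errors total 4 d m-bar(x), which is e times 2 Mm m-bar(x): on either side two one-jump
   asymptotics cost 2 d; truncation below, or the error in N above, costs the rest. *)
move=> e e0; pose d := e * Mm / 2.
have d0 : 0 < d by rewrite divr_gt0// mulr_gt0.
have [A0 A00 hA0] := trunc_mgf_near m g _ (ltW g0) fi d0.
have dC : 0 < 2 * d / C by rewrite divr_gt0// mulr_gt0.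
have [A1 A10 /(_ (Num.max A0 A1))] := sum_tail_near _ _ _ md md dC.
set A := Num.max A0 A1 => hA.
have A1A : A1 <= A by rewrite le_max lexx orbT.
have A0A : A0 <= A by rewrite le_max lexx.
have A_ge0 : 0 <= A by lra.
have /andP[m1 m2] := hA0 A A0A.
have h1 := hA A1A; have h2 := one_jump_asym g g0 m m A _ mL A_ge0 d0.
near=> x; rewrite tail_conv.
have x1 : sum_tail m m x <= one_jump m m A x + one_jump m m A x + 2 * d / C * N x by near: x.
have /andP[x2 x3] : (trunc_mgf m g A - d) * tail m x <= one_jump m m A x <=
    (trunc_mgf m g A + d) * tail m x by near: x.
have Ax : 2 * A <= x by near: x; apply: nbhs_pinfty_ge; exact: num_real.
have x4 := sum_tail_ge m m A x A_ge0 Ax.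
have J0 : 0 <= two_jumps m m A x by exact: joint_ge0.
have x5 : 2 * d / C * N x <= 2 * d * tail m x.
  rewrite mulrAC ler_pdivrMr// -[leRHS]mulrA ler_pM2l ?mulr_gt0// (mulrC _ C).
  by near: x.
have x6 := ler_wpM2r (tail_ge0 m x) m1.
have x7 := ler_wpM2r (tail_ge0 m x) m2.
have de : e * (2 * Mm * tail m x) = 4 * (d * tail m x) by rewrite /d; lra.
rewrite -/Mm in x6 x7 *; apply/andP; split; lra.
Unshelve. all: by end_near. Qed.

End DominatedTails.

(** * Asymptotic monotonicity in the class M *)

Section ClassM.
Context {R : realType}.
Implicit Types (m : probability R R).

(** In the convex combination f1 is almost shift invariant and f2 decreases, so a positive shift
    cannot increase it by a fixed factor. *)
Lemma classM_shift (k : R -> R) t e : classM k -> 0 <= t -> 0 < e ->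
  \forall x \near +oo, k (x + t) <= (1 + e) * k x.
Proof.
move=> [_ [_ [_ [a [f1 [f2 [/andP[a0 a1] [[f10 [_ [f1pos f1L]]] [f20 [f2d kh]]]]]]]]]] t0 e0.
pose h x := a * f1 x + (1 - a) * f2 x.
have hpos : \forall x \near +oo, 0 < h x.
  apply: filterS f1pos => x fx; rewrite /h.
  have [->|an] := eqVneq a 0; first by rewrite mul0r add0r subr0 mul1r.
  have p1 : 0 < a * f1 x by apply: mulr_gt0 => //; rewrite lt0r an a0.
  have p2 : 0 <= (1 - a) * f2 x.
    by apply: mulr_ge0; [rewrite subr_ge0|exact: ltW].
  lra.
(* This d gives (1 + d)^2 <= (1 + e) (1 - d), the difference being d (1 - d). *)
pose d := e / (4 + e).
have e40 : 0 < 4 + e by lra.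
have d0 : 0 < d by rewrite divr_gt0.
have de : d * (4 + e) = e by rewrite divfK// gt_eqF.
have d1 : d < 1 by rewrite ltr_pdivrMr//; lra.
have H1 := asym_eq_near _ _ _ kh hpos d0.
have /(near_shift _ 0) H2 := H1.
have H3 := asym_eq_near _ _ _ (f1L t) f1pos d0.
near=> x.
have /andP[x1 _] : (1 - d) * h x <= k x <= (1 + d) * h x by near: x.
have /andP[_ x2] : (1 - d) * h (x + t) <= k (x + t) <= (1 + d) * h (x + t).
  have : forall y, - 0 <= y -> (1 - d) * h (x + y) <= k (x + y) <= (1 + d) * h (x + y) by near: x.
  by apply; rewrite oppr0.
have /andP[_ x3] : (1 - d) * f1 x <= f1 (x + t) <= (1 + d) * f1 x by near: x.
have hx : 0 < h x by near: x.
have x4 : h (x + t) <= (1 + d) * h x.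
  have a10 : 0 <= 1 - a by lra.
  have b1 := ler_wpM2l a0 x3.
  have b2 : (1 - a) * f2 (x + t) <= (1 - a) * f2 x by rewrite ler_wpM2l// f2d// lerDl.
  have b3 : 0 <= d * ((1 - a) * f2 x).
    by apply: mulr_ge0; [exact: ltW|apply: mulr_ge0 => //; exact: ltW].
  rewrite /h; lra.
have d1' : 0 < 1 - d by lra.
have x5 := ler_wpM2l (ltW (ltr_pwDl ltr01 (ltW d0))) x4.
rewrite -(ler_pM2l d1').
have x6 : k (x + t) <= (1 + d) * ((1 + d) * h x) by exact: le_trans x5.
apply: (le_trans (ler_wpM2l (ltW d1') x6)).
have kx : 0 <= k x by apply: le_trans x1; rewrite ltW// mulr_gt0.
have x7 := ler_wpM2l (sqr_ge0 (1 + d)) x1.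
have x8 : (1 + d) ^+ 2 <= (1 + e) * (1 - d).
  have : 0 < d * (1 - d) by rewrite mulr_gt0.
  move: de; rewrite expr2; lra.
have := ler_wpM2r kx x8; move: x7; rewrite expr2; lra.
Unshelve. all: by end_near. Qed.

End ClassM.

(* nu plays the role of mu^{n*}: any probability measure agreeing with the
   n-th convolution power of mu on measurable sets. *)
Theorem theorem1p2 (R : realType) (gamma : R) (mu : probability R R)
  (n : nat) (nu : probability R R) :
  0 < gamma ->
  classM (fun x => expR (gamma * x) * tail mu x) ->
  (forall A : set R, measurable A -> nu A = convpow mu n A) ->
  classSgamma gamma nu ->
  classSgamma gamma mu.
Proof.
move=> g0 muM; case: n => [|n] nuE nuS.
  (* The zeroth power is the Dirac mass at 0, whose tail vanishes at 0, against the positivity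
     required in L(gamma). *)
  have : 0 < tail nu 0 by case: nuS => -[].
  by rewrite /tail set_mem_set nuE//= /dirac/= indicE mem_setE in_itv/= !ltxx.
have factor (r : probability R R) : (forall A, measurable A -> r A = convpow mu n A) ->
    forall x, tail nu x = sum_tail mu r x.
  move=> rE x; rewrite -tail_conv /tail set_mem_set nuE//=; congr fine.
  by apply: eq_conv => // B /rE.
have mud : dominated nu mu.
  have [r [_ rE]] := convpow_ind mu (fun=> True) n (fun _ _ => I) (fun _ _ _ _ => I).
  exact: (dominated_factor gamma nu nuS _ _ (factor r rE)).
(* The relative error given by class M becomes an error in N through domination; C + 1 guards
   against C = 0. *)
have muD : asym_decreasing gamma nu mu.
  have [C C0 muC] := mud => t t0 e e0.
  have C1 : 0 < C + 1 by rewrite ltr_wpDl.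
  have eC : 0 < e / (C + 1) by rewrite divr_gt0.
  have := classM_shift _ _ _ muM t0 eC; apply: filterS => x.
  rewrite mulrDr expRD => h; have E0 := expR_gt0 (gamma * x).
  have {}h : expR (gamma * t) * tail mu (x + t) <= (1 + e / (C + 1)) * tail mu x.
    by rewrite -(ler_pM2l E0) mulrA mulrCA.
  have E : expR (- gamma * t) * expR (gamma * t) = 1 by rewrite -expRD mulNr addNr expR0.
  have := ler_wpM2l (expR_ge0 (- gamma * t)) h; rewrite mulrA E mul1r => /le_trans; apply.
  rewrite mulrDl mul1r mulrDr lerD2l.
  have le1 : expR (- gamma * t) <= 1.
    by rewrite -[leRHS]expR0 ler_expR mulNr oppr_le0 mulr_ge0// ltW.
  apply: (le_trans (_ : _ <= 1 * (e / (C + 1) * tail mu x))).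
    by apply: ler_wpM2r => //; rewrite mulr_ge0 ?tail_ge0// ltW.
  rewrite mul1r mulrAC ler_pdivrMr// -mulrA ler_pM2l// mulrC (le_trans (muC x))//.
  by rewrite mulrDl mul1r lerDl tail_ge0.
pose good r := dominated nu r /\ asym_decreasing gamma nu r.
have good0 (r : probability R R) : (forall x, 0 <= x -> tail r x = 0) -> good r.
  move=> r0; split.
    apply: (dominated_near gamma nu nuS _ 0); exists 0; split => // x x0.
    by rewrite mul0r r0// ltW.
  move=> t t0 e e0; exists 0; split=> // x x0.
  have -> : tail r (x + t) = 0 by apply: r0; lra.
  by apply: addr_ge0; apply: mulr_ge0; rewrite ?expR_ge0 ?tail_ge0// ltW.
have goodS (r r' : probability R R) : (forall x, tail r' x = sum_tail mu r x) -> good r -> good r'.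
  move=> rE [rd rD]; split; first exact: (dominated_conv gamma g0 nu nuS _ _ _ mud rd rE).
  exact: (asym_decreasing_conv gamma g0 nu nuS _ _ _ mud rd muD rD rE).
have [r [[rd rD] rE]] := convpow_ind mu good n good0 goodS.
have muI : asym_increasing gamma nu mu.
  exact: (asym_increasing_factor gamma g0 nu nuS _ _ mud rd muD rD (factor r rE)).
(* A second induction is needed because control by mu rests on [muI], which was itself derived from
   the powers being [good]. *)
have [r' [[[r'd r'D] r'C] r'E]] : exists r' : probability R R, (good r' /\ controlled nu mu r') /\
    forall A, measurable A -> r' A = convpow mu n A.
  apply: convpow_ind => [s s0|s s' sE [sg sC]].
    split; first exact: good0.
    move=> e e0; exists 0; first by [].
    exists 0; split => // x x0.
    by rewrite s0 ?(ltW x0)// mul0r add0r; apply: mulr_ge0; rewrite ?tail_ge0// ltW.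
  split; first exact: goodS sg.
  exact: (controlled_conv gamma g0 nu nuS _ _ _ mud sg.1 muI sC sE).
have half0 : 0 < 2^-1 :> R by lra.
(* Half of N is absorbed on the left, so N <= 2 * C * mu-bar eventually; the added 1 makes the
   constant positive. *)
have [C C0 hC] := controlled_conv gamma g0 nu nuS _ _ _ mud r'd muI r'C (factor r' r'E) _ half0.
apply: (classSgamma_of_equiv gamma g0 nu nuS mu (2 * C + 1)) => //; first lra.
apply: filterS hC => x hx; have := tail_ge0 mu x; lra.
Qed.
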